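(* $\mathrm{GRA}(e,p,s,I,\neg,J)$ is equiexpressive with the set of quantifier-free $\mathrm{FO}$-formulas; that is, every term of $\mathrm{GRA}(e,p,s,I,\neg,J)$ has an equivalent quantifier-free $\mathrm{FO}$-formula, and every quantifier-free $\mathrm{FO}$-formula has an equivalent term of $\mathrm{GRA}(e,p,s,I,\neg,J)$.
   Context: AD-relations. $A^0=\{\epsilon\}$, with $\epsilon$ the empty tuple. A $k$-ary AD-relation over a set $A$ is a pair $(R,k)$ with $R\subseteq A^k$, $k\ge 0$; $t\in(R,k)$ means $t\in R$. Vocabularies contain only relation symbols (of any arity $k\ge 0$). Models have nonempty domains; $A$ is the domain of $\mathfrak{A}$. Terms. $\mathrm{GRA}(e,p,s,I,\neg,J)$ is the set of terms built from relation symbols and the constant $e$ by the unary operators $p,s,I,\neg$ and the binary operator $J$. Each term $\mathcal{T}$ defines in each model $\mathfrak{A}$ an AD-relation $\mathcal{T}^{\mathfrak{A}}$ of arity $\mathit{ar}(\mathcal{T})$. Let $k=\mathit{ar}(\mathcal{T})$, $\ell=\mathit{ar}(\mathcal{S})$. - $R^{\mathfrak{A}}$ is the interpretation of $R$, paired with the arity of $R$; $e^{\mathfrak{A}}=(\{(a,a)\mid a\in A\},2)$. - If $k\ge2$: $(p\mathcal{T})^{\mathfrak{A}}=(\{(a_k,a_1,\dots,a_{k-1})\mid(a_1,\dots,a_k)\in\mathcal{T}^{\mathfrak{A}}\},k)$; $(s\mathcal{T})^{\mathfrak{A}}=(\{(a_1,\dots,a_{k-2},a_k,a_{k-1})\mid(a_1,\dots,a_k)\in\mathcal{T}^{\mathfrak{A}}\},k)$;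 $(I\mathcal{T})^{\mathfrak{A}}=(\{(a_1,\dots,a_{k-1})\mid(a_1,\dots,a_k)\in\mathcal{T}^{\mathfrak{A}},\ a_{k-1}=a_k\},k-1)$. If $k\le1$, each of $p\mathcal{T},s\mathcal{T},I\mathcal{T}$ is interpreted as $\mathcal{T}^{\mathfrak{A}}$. - $(\neg\mathcal{T})^{\mathfrak{A}}=(\{t\in A^k\mid t\notin\mathcal{T}^{\mathfrak{A}}\},k)$. - $(J(\mathcal{T},\mathcal{S}))^{\mathfrak{A}}=(\{(a_1,\dots,a_k,b_1,\dots,b_\ell)\mid(a_1,\dots,a_k)\in\mathcal{T}^{\mathfrak{A}},(b_1,\dots,b_\ell)\in\mathcal{S}^{\mathfrak{A}}\},k+\ell)$. Formulas. $\mathrm{FO}$ is first-order logic with equality over relation symbols, with variables $v_1,v_2,\dots$. A formula $\varphi$ whose free variables are exactly $v_{i_1},\dots,v_{i_k}$ with $i_1<\dots<i_k$ defines $\varphi^{\mathfrak{A}}=(\{(a_1,\dots,a_k)\in A^k\mid\mathfrak{A}\models\varphi(a_1,\dots,a_k)\},k)$, where $a_j$ is assigned to $v_{i_j}$. A formula $\varphi$ and a term $\mathcal{T}$ are equivalent if $\varphi^{\mathfrak{A}}=\mathcal{T}^{\mathfrak{A}}$ for every model $\mathfrak{A}$ whose vocabulary contains all symbols of $\varphi$ and $\mathcal{T}$. *)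

(* Defs.v *)
From mathcomp Require Import all_boot.
From mathcomp Require Import boolp classical_sets.

Set Implicit Arguments.
Unset Strict Implicit.
Unset Printing Implicit Defensive.

Local Open Scope classical_set_scope.

(** * AD-relations *)

Record adrel (A : Type) := ADRel { arity : nat; tuples : set (arity.-tuple A) }.
Arguments ADRel {A arity} tuples.
Arguments tuples {A} a _.

Definition ad_e (A : Type) : adrel A :=
  ADRel [set t : 2.-tuple A | exists a, t = [tuple a; a]].

(* In the three operators below, the first branch is the case of arity >= 2. *)

Definition ad_p (A : Type) (X : adrel A) : adrel A :=
  match X with
  | @ADRel _ n.+2 R =>
      ADRel [set t : n.+2.-tuple A | exists (u : n.+1.-tuple A) (a : A),
        R [tuple of rcons u a] /\ t = [tuple of a :: u]]
  | _ => X
  end.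

Definition ad_s (A : Type) (X : adrel A) : adrel A :=
  match X with
  | @ADRel _ n.+2 R =>
      ADRel [set t : n.+2.-tuple A | exists (u : n.-tuple A) (a b : A),
        R [tuple of rcons (rcons u a) b] /\ t = [tuple of rcons (rcons u b) a]]
  | _ => X
  end.

Definition ad_I (A : Type) (X : adrel A) : adrel A :=
  match X with
  | @ADRel _ n.+2 R =>
      ADRel [set t : n.+1.-tuple A | exists (u : n.-tuple A) (a : A),
        R [tuple of rcons (rcons u a) a] /\ t = [tuple of rcons u a]]
  | _ => X
  end.

Definition ad_neg (A : Type) (X : adrel A) : adrel A := ADRel (~` tuples X).

Definition ad_J (A : Type) (X Y : adrel A) : adrel A :=
  ADRel [set t : (arity X + arity Y).-tuple A | exists u v,
    [/\ tuples X u, tuples Y v & t = [tuple of u ++ v]]].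

(** * Relation symbols and models *)

(* The stock of all available relation symbols; a vocabulary is a set of them. *)
Record symbols := Symbols { sym :> Type; sym_arity : sym -> nat }.

Record model (S : symbols) := Model {
  dom :> Type;
  dom_nonempty : inhabited dom;
  voc : set S;
  interp : forall r : S, voc r -> set ((sym_arity r).-tuple dom)
}.
Arguments voc {S} m _.

(* Symbols outside the vocabulary of [M] get the empty relation, so that
   evaluation is total; equivalence below never looks at such a value. *)
Definition interp_sym (S : symbols) (M : model S) (r : S) :
    set ((sym_arity r).-tuple M) :=
  [set t | exists h : voc M r, interp h t].
Arguments interp_sym {S} M r _.

(** * Terms *)

Inductive term (S : symbols) :=
| TSym of S
| TE
| TP of term S
| TS of term S
| TI of term S
| TNeg of term S
| TJ of term S & term S.
Arguments TE {S}.

Fixpoint term_rel (S : symbols) (M : model S) (T : term S) : adrel M :=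
  match T with
  | TSym r => ADRel (interp_sym M r)
  | TE => ad_e M
  | TP T1 => ad_p (term_rel M T1)
  | TS T1 => ad_s (term_rel M T1)
  | TI T1 => ad_I (term_rel M T1)
  | TNeg T1 => ad_neg (term_rel M T1)
  | TJ T1 T2 => ad_J (term_rel M T1) (term_rel M T2)
  end.

Fixpoint term_syms (S : symbols) (T : term S) : set S :=
  match T with
  | TSym r => [set r]
  | TE => set0
  | TP T1 | TS T1 | TI T1 | TNeg T1 => term_syms T1
  | TJ T1 T2 => term_syms T1 `|` term_syms T2
  end.

(** * First-order formulas *)

(* The variable v_(i+1) is represented by the number i.  There are no logical
   constants for truth and falsity: without 0-ary relation symbols, no term
   has arity 0. *)
Inductive formula (S : symbols) :=
| FEq of nat & nat
| FSym (r : S) of (sym_arity r).-tuple nat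
| FNeg of formula S
| FAnd of formula S & formula S
| FOr of formula S & formula S
| FImp of formula S & formula S
| FEx of nat & formula S
| FAll of nat & formula S.

Fixpoint quantifier_free (S : symbols) (phi : formula S) : bool :=
  match phi with
  | FEq _ _ | FSym _ _ => true
  | FNeg f => quantifier_free f
  | FAnd f g | FOr f g | FImp f g => quantifier_free f && quantifier_free g
  | FEx _ _ | FAll _ _ => false
  end.

Fixpoint free_occ (S : symbols) (phi : formula S) : seq nat :=
  match phi with
  | FEq i j => [:: i; j]
  | FSym _ x => x
  | FNeg f => free_occ f
  | FAnd f g | FOr f g | FImp f g => free_occ f ++ free_occ g
  | FEx i f | FAll i f => [seq j <- free_occ f | j != i]
  end.

Definition free_vars (S : symbols) (phi : formula S) : seq nat :=
  sort leq (undup (free_occ phi)).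

Definition update (A : Type) (g : nat -> A) (i : nat) (a : A) : nat -> A :=
  fun j => if j == i then a else g j.

Fixpoint sat (S : symbols) (M : model S) (g : nat -> M) (phi : formula S)
    : Prop :=
  match phi with
  | FEq i j => g i = g j
  | FSym r x => interp_sym M r [tuple of map g x]
  | FNeg f => ~ sat g f
  | FAnd f1 f2 => sat g f1 /\ sat g f2
  | FOr f1 f2 => sat g f1 \/ sat g f2
  | FImp f1 f2 => sat g f1 -> sat g f2
  | FEx i f => exists a : M, sat (update g i a) f
  | FAll i f => forall a : M, sat (update g i a) f
  end.

(* As [sat] depends only on the values of [g] at the free variables, and the
   domain is nonempty, it is immaterial which extension [g] of the tuple to all
   variables is used. *)
Definition formula_rel (S : symbols) (M : model S) (phi : formula S) : adrel M :=
  ADRel [set t : (size (free_vars phi)).-tuple M | exists g : nat -> M,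
    t = [tuple of map g (in_tuple (free_vars phi))] /\ sat g phi].

Fixpoint formula_syms (S : symbols) (phi : formula S) : set S :=
  match phi with
  | FEq _ _ => set0
  | FSym r _ => [set r]
  | FNeg f | FEx _ f | FAll _ f => formula_syms f
  | FAnd f g | FOr f g | FImp f g => formula_syms f `|` formula_syms g
  end.

Definition equivalent (S : symbols) (phi : formula S) (T : term S) : Prop :=
  forall M : model S, formula_syms phi `|` term_syms T `<=` voc M ->
    formula_rel M phi = term_rel M T.

(* Main.v *)
(** Membership in an AD-relation is tested on lists [map g l], where [l] lists
    variables and [g] is an assignment; the operators [p], [s], [I] then only
    alter [l].  Hence a term [T] together with any list [l] of [ar T] variables,
    repetitions allowed, is expressed by a quantifier-free formula, by induction
    on [T].  Conversely [p] and [s] generate all permutations of the list, and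
    [I] merges two equal entries at its end, so that every list of arguments can
    be brought to sorted, duplicate-free form; applied after [J] this expresses
    conjunction. *)
Require Import Defs.
From mathcomp Require Import all_boot.
From mathcomp Require Import boolp classical_sets.
From mathcomp Require Import zify.

Set Implicit Arguments.
Unset Strict Implicit.
Unset Printing Implicit Defensive.

(** * Membership of lists in AD-relations *)

(** Lists keep arities out of the types, so concatenated or rotated arguments are compared without
    transport. *)
Definition holds (A : Type) (X : adrel A) (s : seq A) : Prop :=
  exists2 t, tuples X t & tval t = s.

Lemma holds_size A (X : adrel A) s : holds X s -> size s = arity X.
Proof. by case=> t _ <-; rewrite size_tuple. Qed.

Lemma holds_tuple A n (R : set (n.-tuple A)) (t : n.-tuple A) :
  holds (ADRel R) t <-> R t.
Proof.
split=> [[u /= Ru /val_inj <-] //|Rt]; by exists t.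
Qed.

Lemma adrel_eq A (X Y : adrel A) :
  arity X = arity Y -> (forall s, holds X s <-> holds Y s) -> X = Y.
Proof.
case: X Y => [n R] [m Q] /= eq_nm; case: m / eq_nm Q => Q RQ.
congr ADRel; rewrite funeqE => t; rewrite propeqE.
by rewrite -!holds_tuple.
Qed.

Lemma holds_neg A (X : adrel A) s :
  size s = arity X -> holds (ad_neg X) s <-> ~ holds X s.
Proof.
move=> /eqP sz_s; have -> : s = Tuple sz_s by [].
by case: X sz_s => n R sz_s; rewrite !holds_tuple.
Qed.

(** The size of [s1] fixes where the concatenation splits, so the decomposition is unique. *)
Lemma holds_J A (X Y : adrel A) s1 s2 : size s1 = arity X ->
  holds (ad_J X Y) (s1 ++ s2) <-> holds X s1 /\ holds Y s2.
Proof.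
move=> sz1; split=> [[_ [u [v [Xu Yv ->]]] /= uv]|[[u Xu <-] [v Yv <-]]].
  have sz_u : size u = size s1 by rewrite size_tuple.
  move: (congr1 (take (size s1)) uv) (congr1 (drop (size s1)) uv).
  rewrite !take_size_cat // !drop_size_cat // => <- <-.
  by split; [exists u | exists v].
by exists [tuple of u ++ v] => //; exists u, v.
Qed.

Lemma holds_e A (a b : A) : holds (ad_e A) [:: a; b] <-> a = b.
Proof.
by split=> [[_ [c ->] [<- <-]]|->] //; exists [tuple b; b] => //; exists b.
Qed.

Lemma arity_p A (X : adrel A) : arity (ad_p X) = arity X.
Proof. by case: X => [[|[|n]] R]. Qed.

Lemma arity_s A (X : adrel A) : arity (ad_s X) = arity X.
Proof. by case: X => [[|[|n]] R]. Qed.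

(** Undoing the move of the last entry to the front is [rot 1], which is the identity on lists of
    length at most 1, as [ad_p] is in those arities. *)
Lemma holds_p A (X : adrel A) s : holds (ad_p X) s <-> holds X (rot 1 s).
Proof.
case: X => [[|[|n]] R].
- by split=> Xs; have := holds_size Xs; rewrite ?size_rot; case: s Xs.
- by split=> Xs; have := holds_size Xs; rewrite ?size_rot;
     case: s Xs => [|a [|b s]].
split=> [[_ [u [a [Ru ->]]] <-]|[t /= Rt]].
  by exists [tuple of rcons u a] => //=; rewrite rot1_cons.
case: s => [|a u]; first by move/(congr1 size); rewrite size_tuple.
rewrite rot1_cons => tE; have /eqP := size_tuple t.
rewrite tE size_rcons eqSS => sz_u; exists [tuple of a :: Tuple sz_u] => //.
exists (Tuple sz_u), a; split=> //.
by suff <- : t = [tuple of rcons (Tuple sz_u) a] by []; apply: val_inj.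
Qed.

Lemma rcons2 T (s : seq T) a b : rcons (rcons s a) b = s ++ [:: a; b].
Proof. by rewrite -!cats1 -catA. Qed.

Lemma holds_s_small A (X : adrel A) s :
  arity X < 2 -> holds (ad_s X) s <-> holds X s.
Proof. by case: X => [[|[|n]] R]. Qed.

Lemma holds_s A (X : adrel A) s a b :
  holds (ad_s X) (s ++ [:: a; b]) <-> holds X (s ++ [:: b; a]).
Proof.
rewrite -!rcons2; case: X => [[|[|n]] R].
- by split=> /holds_size; rewrite !size_rcons.
- by split=> /holds_size; rewrite !size_rcons.
split=> [[_ [u [c [d [Ru ->]]]]]|[t /= Rt tE]].
  move=> /= /rcons_inj[/rcons_inj[<- <-] <-].
  by exists [tuple of rcons (rcons u c) d].
have /eqP := size_tuple t; rewrite tE !size_rcons !eqSS => sz_s.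
exists [tuple of rcons (rcons (Tuple sz_s) a) b] => //.
exists (Tuple sz_s), b, a; split=> //.
suff <- : t = [tuple of rcons (rcons (Tuple sz_s) b) a] by [].
exact: val_inj.
Qed.

Lemma holds_I A (X : adrel A) s a : arity X = (size s).+2 ->
  holds (ad_I X) (rcons s a) <-> holds X (s ++ [:: a; a]).
Proof.
rewrite -rcons2; case: X => [[|[|n]] R] //= [] nE.
split=> [[_ [u [c [Ru ->]]] /= /rcons_inj[<- <-]]|[t /= Rt tE]].
  by exists [tuple of rcons (rcons u c) c].
have /eqP sz_s : size s = n by [].
exists [tuple of rcons (Tuple sz_s) a] => //.
exists (Tuple sz_s), a; split=> //.
suff <- : t = [tuple of rcons (rcons (Tuple sz_s) a) a] by [].
exact: val_inj.
Qed.

(** * Arities of terms and a criterion for equivalence *)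

Section Equiexpressivity.
Variable S : symbols.
Implicit Types (T : term S) (phi : formula S) (x y l : seq nat).

Fixpoint term_arity T : nat :=
  match T with
  | TSym r => sym_arity r
  | TE => 2
  | TP T1 | TS T1 | TNeg T1 => term_arity T1
  | TI T1 => if term_arity T1 is n.+2 then n.+1 else term_arity T1
  | TJ T1 T2 => term_arity T1 + term_arity T2
  end.

Lemma arity_term_rel (M : model S) T : arity (term_rel M T) = term_arity T.
Proof.
elim: T => //= [T <-|T <-|T <-|T1 <- T2 <-] //.
- exact: arity_p.
- exact: arity_s.
- by case: (term_rel M T) => [[|[|n]] R].
Qed.

Lemma free_vars_uniq phi : uniq (free_vars phi).
Proof. by rewrite sort_uniq undup_uniq. Qed.

Lemma sort_undup_eq x y : x =i y -> sort leq (undup x) = sort leq (undup y).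
Proof.
move=> xy; apply/(perm_sortP leq_total leq_trans anti_leq).
by apply: uniq_perm; rewrite ?undup_uniq// => i; rewrite !mem_undup.
Qed.

Lemma equivalent_holds phi T : term_arity T = size (free_vars phi) ->
  (forall (M : model S) (g : nat -> M),
     sat g phi <-> holds (term_rel M T) (map g (free_vars phi))) ->
  equivalent phi T.
Proof.
move=> arT satT M _; apply: adrel_eq; first by rewrite arity_term_rel.
move=> s; split=> [[_ [g [-> /satT Tg]] <-] //|Ts].
have sz_s := holds_size Ts; rewrite arity_term_rel arT in sz_s.
case: (dom_nonempty M) => a0.
(* Each free variable gets the entry of [s] at its position; the default [a0] serves all other
   variables. *)
pose g i := nth a0 s (index i (free_vars phi)).
have gE : map g (free_vars phi) = s.
  apply: (@eq_from_nth _ a0) => [|i]; rewrite size_map => // lt_i.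
  by rewrite (nth_map 0) // /g index_uniq ?free_vars_uniq.
exists [tuple of map g (in_tuple (free_vars phi))]; last exact: gE.
by exists g; split=> //; apply/satT; rewrite gE.
Qed.

(** * From terms to quantifier-free formulas *)

(** The list [l] is generalized because each operator passes an altered list to its subterm: rotated
    for [p], with its end swapped for [s], with its last entry doubled for [I], split for [J]. *)
Lemma formula_of_term T l : size l = term_arity T -> exists phi,
  [/\ quantifier_free phi, free_occ phi =i l &
      forall (M : model S) (g : nat -> M),
        sat g phi <-> holds (term_rel M T) (map g l)].
Proof.
elim: T l => /= [r||T IH|T IH|T IH|T IH|T1 IH1 T2 IH2] l sz_l.
- have /eqP sz := sz_l; exists (FSym (Tuple sz)); split=> // M g /=.
  by rewrite -holds_tuple.
- case: l sz_l => [|i [|j []]] //= _.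
  by exists (FEq S i j); split=> // M g /=; rewrite holds_e.
- have [|phi [qf fv satT]] := IH (rot 1 l); first by rewrite size_rot.
  exists phi; split=> // [i|M g]; first by rewrite fv mem_rot.
  by rewrite holds_p -map_rot.
- have [small|big] := ltnP (size l) 2.
    have [phi [qf fv satT]] := IH l sz_l.
    by exists phi; split=> // M g; rewrite holds_s_small ?arity_term_rel -?sz_l.
  case/lastP: l sz_l big => [|l a]; first by [].
  case/lastP: l => [|l b]; first by [].
  rewrite rcons2 => sz_l _.
  have [|phi [qf fv satT]] := IH (l ++ [:: a; b]).
    by rewrite -sz_l !size_cat.
  exists phi; split=> // [i|M g].
    by rewrite fv !mem_cat !inE [X in _ || X]orbC.
  by rewrite satT !map_cat holds_s.
- have [[m arT]|arT] : (exists m, term_arity T = m.+2) \/ term_arity T < 2.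
    by case: (term_arity T) => [|[|m]]; [right|right|left; exists m].
  + rewrite arT in sz_l; case/lastP: l sz_l => [|l a] //.
    rewrite size_rcons => -[sz_l].
    have [|phi [qf fv satT]] := IH (l ++ [:: a; a]).
      by rewrite arT size_cat sz_l addn2.
    exists phi; split=> // [i|M g].
      by rewrite fv mem_cat mem_rcons !inE orbb orbC.
    by rewrite satT map_rcons map_cat holds_I // arity_term_rel arT size_map sz_l.
  (* In arity below 2 the operator [I] changes nothing, so the formula for [T] serves again. *)
  + have [|phi [qf fv satT]] := IH l.
      by rewrite sz_l; case: (term_arity T) arT => [|[|m]].
    exists phi; split=> // M g; rewrite satT.
    rewrite -(arity_term_rel M T) in arT.
    by case: (term_rel M T) arT => [[|[|n]] R].
- have [phi [qf fv satT]] := IH l sz_l.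
  exists (FNeg phi); split=> // M g /=.
  by rewrite satT holds_neg // size_map arity_term_rel.
- have sz1 : size (take (term_arity T1) l) = term_arity T1.
    by rewrite size_takel // sz_l leq_addr.
  have [phi1 [qf1 fv1 sat1]] := IH1 _ sz1.
  have [|phi2 [qf2 fv2 sat2]] := IH2 (drop (term_arity T1) l).
    by rewrite size_drop sz_l addKn.
  exists (FAnd phi1 phi2); split=> [|i|M g] /=; first by rewrite qf1.
    by rewrite mem_cat fv1 fv2 -mem_cat cat_take_drop.
  rewrite sat1 sat2 -holds_J ?size_map ?arity_term_rel //.
  by rewrite -map_cat cat_take_drop.
Qed.

(** * Rearranging argument lists by terms *)

(** The new term is chosen before [M] and [g], so one term works uniformly in all models. *)
Definition reduces x y : Prop := forall T, term_arity T = size x ->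
  exists2 T', term_arity T' = size y & forall (M : model S) (g : nat -> M),
    holds (term_rel M T') (map g y) <-> holds (term_rel M T) (map g x).

Lemma reduces_refl x : reduces x x.
Proof. by move=> T arT; exists T. Qed.
Arguments reduces_refl : clear implicits.

Lemma reduces_trans x y z : reduces x y -> reduces y z -> reduces x z.
Proof.
move=> xy yz T /xy[T1 /yz[T2 ar2 h2] h1].
by exists T2 => // M g; rewrite h2.
Qed.
Arguments reduces_trans {x y z} _ _ T _.

Lemma reduces_rotr1 x : reduces x (rotr 1 x).
Proof.
move=> T arT; exists (TP T) => [|M g] /=; first by rewrite size_rotr.
by rewrite holds_p -map_rot rotrK.
Qed.
Arguments reduces_rotr1 : clear implicits.

(** Iterated rotation carries the entries of [y] one by one from the back to the front. *)
Lemma reduces_catC x y : reduces (x ++ y) (y ++ x).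
Proof.
elim/last_ind: y x => [|y a IH] x; first by rewrite cats0; apply: reduces_refl.
apply: (reduces_trans (reduces_rotr1 _) _); rewrite -rcons_cat rotr1_rcons.
by rewrite cat_rcons; apply: (IH (a :: x)).
Qed.
Arguments reduces_catC : clear implicits.

(** Rotation brings the pair to the end, [s] exchanges it there, and rotation brings it back. *)
Lemma reduces_swap x y a b : reduces (x ++ [:: a, b & y]) (x ++ [:: b, a & y]).
Proof.
have toend c d : x ++ [:: c, d & y] = (x ++ [:: c; d]) ++ y by rewrite -catA.
rewrite !toend; apply: (reduces_trans (reduces_catC _ _) _).
apply: (reduces_trans _ (reduces_catC _ _)); rewrite !catA => T arT.
exists (TS T) => [|M g] /=; first by rewrite arT !size_cat.
by rewrite !map_cat holds_s.
Qed.
Arguments reduces_swap : clear implicits.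

Lemma reduces_perm x y : perm_eq x y -> reduces x y.
Proof.
(* The prefix [z] collects the entries already passed. *)
suff main z : perm_eq x y -> reduces (z ++ x) (z ++ y) by exact: (main [::]).
elim: x y z => [|a x IH] y z xy.
  by move: xy; rewrite perm_sym => /perm_nilP ->; apply: reduces_refl.
have ay : a \in y by rewrite -(perm_mem xy) mem_head.
case/splitPr: ay xy => y1 y2; rewrite perm_sym perm_catC /= perm_cons.
rewrite perm_catC perm_sym => /IH IHx.
(* The tail is permuted first, behind the prefix [rcons z a]; then adjacent swaps carry [a] past
   [y1]. *)
apply: (@reduces_trans _ (z ++ a :: y1 ++ y2)).
  by rewrite -!(cat_rcons a); apply: IHx.
elim: y1 z {IHx} => [|b y1 IHy] z; first exact: reduces_refl.
apply: (reduces_trans (reduces_swap _ _ _ _) _).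
by rewrite -!(cat_rcons b); apply: IHy.
Qed.
Arguments reduces_perm {x y} _ T _.

Lemma reduces_merge x a : reduces (x ++ [:: a; a]) (rcons x a).
Proof.
move=> T; rewrite size_cat addn2 => arT.
exists (TI T) => [|M g] /=; first by rewrite arT size_rcons.
by rewrite map_rcons map_cat holds_I // arity_term_rel arT size_map.
Qed.
Arguments reduces_merge : clear implicits.

Lemma reduces_undup x : reduces x (undup x).
Proof.
suff main y : reduces (y ++ x) (y ++ undup x) by exact: (main [::]).
elim: x y => [|a x IH] y /=; first exact: reduces_refl.
case: ifPn => ax; last by rewrite -!(cat_rcons a); apply: IH.
(* Since [a] recurs in [x], its first copy is to be absorbed: both copies go to the end, [I] merges
   them, and the survivor returns to its place in [x]. *)
apply: (reduces_trans _ (IH y)).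
case/splitPr: ax => x1 x2.
apply: (@reduces_trans _ ((y ++ x1 ++ x2) ++ [:: a; a])).
  apply: reduces_perm; rewrite -!catA perm_cat2l.
  by apply/permP => P; rewrite !count_cat /= !count_cat /=; lia.
apply: (reduces_trans (reduces_merge _ _) _); apply: reduces_perm.
by apply/permP => P; rewrite -cats1 !count_cat /=; lia.
Qed.
Arguments reduces_undup : clear implicits.

Lemma reduces_sort_undup x : reduces x (sort leq (undup x)).
Proof.
apply: (reduces_trans (reduces_undup x) _); apply: reduces_perm.
by rewrite perm_sym perm_sort.
Qed.
Arguments reduces_sort_undup : clear implicits.

(** * From quantifier-free formulas to terms *)

Definition expressible phi : Prop :=
  exists2 T, term_arity T = size (free_vars phi) &
    forall (M : model S) (g : nat -> M),
      sat g phi <-> holds (term_rel M T) (map g (free_vars phi)).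

Lemma expressible_neg phi : expressible phi -> expressible (FNeg phi).
Proof.
move=> [T arT satT]; exists (TNeg T) => // M g.
by rewrite /= satT holds_neg // size_map arity_term_rel arT.
Qed.

(** [TJ] tests the two variable lists side by side; sorting and merging then identifies the shared
    variables. *)
Lemma expressible_and phi psi :
  expressible phi -> expressible psi -> expressible (FAnd phi psi).
Proof.
move=> [T1 ar1 sat1] [T2 ar2 sat2].
have fvE : free_vars (FAnd phi psi) =
    sort leq (undup (free_vars phi ++ free_vars psi)).
  apply: sort_undup_eq => i.
  by rewrite /= !mem_cat !mem_sort !mem_undup.
have [|T arT holdsT] :=
  reduces_sort_undup (free_vars phi ++ free_vars psi) (TJ T1 T2).
  by rewrite /= ar1 ar2 size_cat.
exists T => [|M g]; rewrite fvE // holdsT map_cat /=.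
by rewrite holds_J ?sat1 ?sat2 // size_map arity_term_rel ar1.
Qed.

Lemma expressible_ext phi psi : free_occ phi = free_occ psi ->
  (forall (M : model S) (g : nat -> M), sat g phi <-> sat g psi) ->
  expressible phi -> expressible psi.
Proof.
by rewrite /expressible /free_vars => -> eq_sat [T arT satT];
   exists T => // M g; rewrite -eq_sat.
Qed.

Lemma quantifier_free_expressible phi : quantifier_free phi -> expressible phi.
Proof.
elim: phi => //= [i j _|r x _|phi IH /IH|phi IH1 psi IH2|phi IH1 psi IH2
  |phi IH1 psi IH2].
(* Sorting and merging covers [i > j] as well as [i = j], where only one free variable remains. *)
- have [//|T arT holdsT] := reduces_sort_undup [:: i; j] TE.
  by exists T => // M g; rewrite holdsT holds_e.
- have [|T arT holdsT] := reduces_sort_undup x (TSym r).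
    by rewrite size_tuple.
  by exists T => // M g; rewrite holdsT /= -holds_tuple.
- exact: expressible_neg.
- by case/andP=> /IH1 e1 /IH2 e2; apply: expressible_and.
(* Disjunction is the negation of the conjunction of the negations. *)
- case/andP=> /IH1/expressible_neg e1 /IH2/expressible_neg e2.
  apply: expressible_ext (expressible_neg (expressible_and e1 e2)) => // M g /=.
  by rewrite not_andP !notK.
(* Implication is the negation of [phi] together with the negation of [psi]. *)
- case/andP=> /IH1 e1 /IH2/expressible_neg e2.
  apply: expressible_ext (expressible_neg (expressible_and e1 e2)) => // M g /=.
  by rewrite not_andP notK implyE.
Qed.

End Equiexpressivity.

Theorem proposition5p2 (S : symbols) :
  (forall T : term S, exists phi : formula S,
     quantifier_free phi = true /\ equivalent phi T) /\
  (forall phi : formula S, quantifier_free phi = true ->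
     exists T : term S, equivalent phi T).
Proof.
split=> [T|phi /quantifier_free_expressible[T arT satT]]; last first.
  by exists T; apply: equivalent_holds.
(* This list is sorted and duplicate-free, so it equals [free_vars phi] and the columns match in
   order. *)
have [|phi [qf fv satT]] := @formula_of_term S T (iota 0 (term_arity T)).
  by rewrite size_iota.
have fvE : free_vars phi = iota 0 (term_arity T).
  rewrite /free_vars (sort_undup_eq fv) undup_id ?iota_uniq //.
  exact: (sorted_sort leq_trans (iota_sorted _ _)).
exists phi; split=> //; apply: equivalent_holds => [|M g].
  by rewrite fvE size_iota.
by rewrite fvE.
Qed.
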